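(* Let $L/K$ be a field extension with $L$ algebraically closed, let $A \subset \mathrm{Aut}_K(L)$ be a subgroup of the group of automorphisms of $L$ over $K$, and let $K' := L^A = \{a \in L \mid \sigma(a) = a \text{ for all } \sigma \in A\}$ be its fixed field. Let $V \subset L^k$ be an affine variety defined over $L$, i.e. $V$ is the vanishing set in $L^k$ of a radical ideal $I = (f_1,\ldots,f_r)$ generated by finitely many polynomials in $L[X_1,\ldots,X_k]$. Let $A$ act on points by acting on the coordinates, and suppose that $V$ is invariant under this action, i.e. $(\sigma(v_1),\ldots,\sigma(v_k)) \in V$ for every $\sigma \in A$ and every $(v_1,\ldots,v_k) \in V$. Then $V$ is defined over $K'$.
   Context: Here $k$ is a positive integer, the number of variables. An affine variety is the vanishing set in $L^k$ of a radical ideal of $L[X_1,\ldots,X_k]$; it is not assumed irreducible. $\mathrm{Aut}_K(L)$ is the group of field automorphisms of $L$ that fix $K$ pointwise. For a subfield $F \subset L$, ''$V$ is defined over $F$'' means that $V$ is the vanishing set in $L^k$ of a radical ideal of $L[X_1,\ldots,X_k]$ that is generated by finitely many polynomials with coefficients in $F$; equivalently (since $L$ is algebraically closed), the ideal $I$ of all polynomials in $L[X_1,\ldots,X_k]$ vanishing on $V$ is generated, as an ideal of $L[X_1,\ldots,X_k]$, by finitely many elements of $F[X_1,\ldots,X_k]$. *)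

(* Defs.v *)
From HB Require Import structures.
From mathcomp Require Import all_boot all_order all_algebra.
From mathcomp Require Import mpoly.

Set Implicit Arguments.
Unset Strict Implicit.
Unset Printing Implicit Defensive.

Import GRing.Theory.
Local Open Scope ring_scope.

(* Subsets are Prop-valued predicates: membership in a fixed field, an ideal
   or a variety is not decidable in general.  Points of L^k are row vectors,
   so applying s to the coordinates of v is [map_mx s v], and the value of a
   polynomial p at v is [p.@[v 0]]. *)

Section Automorphisms.
Variables (K : fieldType) (L : closedFieldType) (iota : {rmorphism K -> L}).

Definition automorphism_over (s : L -> L) : Prop :=
  [/\ zmod_morphism s, monoid_morphism s, bijective s
    & forall a : K, s (iota a) = iota a].

Record aut_subgroup (A : (L -> L) -> Prop) : Prop := AutSubgroup {
  aut_subgroup_sub : forall s, A s -> automorphism_over s;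
  aut_subgroup_id : A id;
  aut_subgroup_comp : forall s t, A s -> A t -> A (s \o t);
  aut_subgroup_inv :
    forall s, A s -> exists t, [/\ A t, cancel s t & cancel t s]
}.

End Automorphisms.

Definition fixed_field (L : closedFieldType) (A : (L -> L) -> Prop) (a : L) :
    Prop :=
  forall s, A s -> s a = a.

Section Varieties.
Variables (L : closedFieldType) (k : nat).

Definition ideal_gen (r : nat) (f : 'I_r -> {mpoly L[k]}) (p : {mpoly L[k]}) :
    Prop :=
  exists c : 'I_r -> {mpoly L[k]}, p = \sum_(i < r) c i * f i.

Definition radical_ideal (I : {mpoly L[k]} -> Prop) : Prop :=
  forall (p : {mpoly L[k]}) (n : nat), I (p ^+ n) -> I p.

Definition vanishing_set (I : {mpoly L[k]} -> Prop) (v : 'rV[L]_k) : Prop :=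
  forall p, I p -> p.@[v 0] = 0.

(* The generators have coefficients in F, but the ideal they generate, and its
   radicality, are taken in L[X_1, ..., X_k]. *)
Definition defined_over (F : L -> Prop) (V : 'rV[L]_k -> Prop) : Prop :=
  exists (r : nat) (f : 'I_r -> {mpoly L[k]}),
    [/\ forall i m, F (f i)@_m,
        radical_ideal (ideal_gen f)
      & forall v, V v <-> vanishing_set (ideal_gen f) v].

Definition invariant_under (A : (L -> L) -> Prop) (V : 'rV[L]_k -> Prop) :
    Prop :=
  forall s v, A s -> V v -> V (map_mx s v).

End Varieties.

(* Main.v *)
Require Import Defs.
From HB Require Import structures.
From mathcomp Require Import all_boot all_order all_algebra.
From mathcomp Require Import mpoly.
From Stdlib Require Import Classical_Prop.

(** The generators over the fixed field come from a reduced Groebner basis of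
    the ideal J of all polynomials vanishing on V: such a basis is determined
    by J alone, hence is fixed by every automorphism that preserves J.

    Call a monomial standard when it is not the leading monomial of an element
    of J.  Modulo J every polynomial is congruent to exactly one combination of
    standard monomials: one exists by cancelling leading terms
    ([normal_form_exists]), and it is unique because a nonzero element of J has
    a leading monomial that is not standard ([normal_form_unique]).  For a
    leading monomial m, let g_m be m minus its normal form.  By uniqueness, g_m
    is fixed by every automorphism of L that preserves J.  Since V is invariant
    under the group A, so is J ([vanishing_poly_map]), and the coefficients of
    each g_m lie in the fixed field of A.  By Dickson's lemma ([dickson])
    finitely many leading monomials divide all the others, and division by the
    corresponding g_m shows that these generate J.

    This proves finite generation along with the descent, and the
    Nullstellensatz does not intervene: J contains any ideal that defines V, so
    its vanishing set is V, and J is radical because L is reduced. *)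

Set Implicit Arguments.
Unset Strict Implicit.
Unset Printing Implicit Defensive.

Import Order.TTheory GRing.Theory.

Section Dickson.
Variable n : nat.
Implicit Types S : 'X_{1..n} -> Prop.

(** The induction is on the number d of coordinates that are compared.  If F
    works for the first d coordinates and N bounds the coordinate d on F, then
    F handles every m whose coordinate d is at least N; for each of the
    finitely many smaller values j, the induction hypothesis applies to the
    slice of S where that coordinate is j. *)
Lemma dickson_first_coordinates d S :
  (d <= n)%N ->
  exists2 F : seq 'X_{1..n}, {in F, forall f, S f} &
    forall m, S m -> exists2 f, f \in F &
      forall i : 'I_n, (i < d)%N -> (f i <= m i)%N.
Proof.
elim: d S => [|d IHd] S ltdn.
  have [[m0 Sm0] | noS] := classic (exists m, S m).
    by exists [:: m0] => [f /[1!inE] /eqP->|m _] //; exists m0; rewrite ?inE.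
  by exists [::] => // m Sm; case: noS; exists m.
pose last := Ordinal ltdn.
have [F SF domF] := IHd S (ltnW ltdn).
pose N := \max_(f <- F) f last.
have /fin_all_exists2[G SG domG] : forall j : 'I_N, exists2 G : seq 'X_{1..n},
    {in G, forall f, S f /\ f last = j} &
    forall m, S m /\ m last = j -> exists2 f, f \in G &
      forall i : 'I_n, (i < d)%N -> (f i <= m i)%N.
  by move=> j; apply: IHd (ltnW ltdn).
exists (F ++ flatten [seq G j | j <- enum 'I_N]) => [f | m Sm].
  rewrite mem_cat => /orP[/SF //|/flatten_mapP[j _ /SG[]] //].
have extend f : f last <= m last ->
    (forall i : 'I_n, (i < d)%N -> (f i <= m i)%N) ->
    forall i : 'I_n, (i < d.+1)%N -> (f i <= m i)%N.
  move=> le_last le_d i; rewrite ltnS leq_eqVlt => /orP[/eqP eqid|/le_d //].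
  by have -> : i = last by apply: val_inj.
have [leNm | ltmN] := leqP N (m last).
  have [f Ff le_d] := domF m Sm; exists f; first by rewrite mem_cat Ff.
  by apply: extend => //; apply: leq_trans leNm; apply: leq_bigmax_seq.
have [f Gf le_d] := domG (Ordinal ltmN) m (conj Sm erefl); exists f.
  rewrite mem_cat; apply/orP; right; apply/flatten_mapP.
  by exists (Ordinal ltmN); rewrite ?mem_enum.
by apply: extend => //; have [_ ->] := SG _ _ Gf.
Qed.

Lemma dickson S :
  exists2 F : seq 'X_{1..n}, {in F, forall f, S f} &
    forall m, S m -> exists2 f, f \in F & (f <= m)%MM.
Proof.
have [F SF domF] := dickson_first_coordinates S (leqnn n).
exists F => // m /domF[f Ff le_f_m]; exists f => //.
by apply/mnm_lepP => i; apply: le_f_m.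
Qed.

End Dickson.

Local Open Scope ring_scope.

Section InvariantGenerators.
Variables (F : fieldType) (n : nat).
Implicit Types (p q r : {mpoly F[n]}) (m : 'X_{1..n}).

(** Noetherian induction on the leading monomial, in the form of a division
    algorithm: for the induction step it is enough to cancel the leading term
    of p against some q with the same one. *)
Lemma mpoly_cancel_lead_ind (P : {mpoly F[n]} -> Prop) :
  P 0 ->
  (forall p, p != 0 ->
    (forall q, mlead q = mlead p -> mleadc q = mleadc p -> P (p - q)) -> P p) ->
  forall p, P p.
Proof.
move=> P0 Pstep; elim/mleadrect => p IHp.
have [-> //|p_neq0] := eqVneq p 0.
apply: Pstep => // q lead_q leadc_q.
have [-> //|pq_neq0] := eqVneq (p - q) 0; apply: IHp.
rewrite lt_neqAle; apply/andP; split; last first.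
  by rewrite (le_trans (mleadB_le p q)) // lead_q joinxx.
apply: contra pq_neq0 => /eqP lead_pq.
by rewrite -mleadc_eq0 lead_pq mcoeffB -leadc_q lead_q subrr.
Qed.

Variable J : {mpoly F[n]} -> Prop.
Hypotheses (J0 : J 0) (JD : forall p q, J p -> J q -> J (p + q))
           (JM : forall c p, J p -> J (c * p)).

Let JB p q : J p -> J q -> J (p - q).
Proof. by move=> Jp Jq; apply: JD => //; rewrite -mulN1r; apply: JM. Qed.

Definition lead_monomial m := exists q, [/\ J q, q != 0 & mlead q = m].

Definition standard r := forall m, lead_monomial m -> r@_m = 0.

Lemma normal_form_exists p : exists2 r, standard r & J (p - r).
Proof.
elim/mpoly_cancel_lead_ind: p => [|p p_neq0 IHp].
  by exists 0 => [m _|]; rewrite ?subr0 ?mcoeff0.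
have [[q [Jq q_neq0 lead_q]]|std_p] := classic (lead_monomial (mlead p)).
  have lcq_neq0 : mleadc q != 0 by rewrite mleadc_eq0.
  have lcp_neq0 : mleadc p != 0 by rewrite mleadc_eq0.
  pose c := mleadc p / mleadc q.
  have c_neq0 : c != 0 by rewrite mulf_neq0 ?invr_eq0.
  have [||r std_r Jr] := IHp (c *: q).
  - by rewrite mleadZ.
  - by rewrite mleadZ // mcoeffZ divfK.
  exists r => //; have := JD Jr (JM c%:MP Jq).
  by rewrite mul_mpolyC addrAC subrK.
have lcp_neq0 : mleadc p != 0 by rewrite mleadc_eq0.
have [||r std_r Jr] := IHp (mleadc p *: 'X_[mlead p]).
- by rewrite mleadZ // mleadXm.
- by rewrite mleadZ // mleadXm mcoeffZ mcoeffX eqxx mulr1.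
exists (r + mleadc p *: 'X_[mlead p]) => [m lead_m|].
  rewrite mcoeffD std_r // mcoeffZ mcoeffX.
  case: eqP => [eq_m|_]; last by rewrite mulr0 addr0.
  by case: std_p; rewrite eq_m.
by rewrite opprD addrA addrAC.
Qed.

Lemma standard_ideal_eq0 r : standard r -> J r -> r = 0.
Proof.
move=> std_r Jr; apply/eqP; apply/negPn/negP => r_neq0.
have /eqP := std_r (mlead r) (ex_intro _ r (And3 Jr r_neq0 erefl)).
by rewrite mleadc_eq0 (negbTE r_neq0).
Qed.

Lemma normal_form_unique p r1 r2 :
  standard r1 -> standard r2 -> J (p - r1) -> J (p - r2) -> r1 = r2.
Proof.
move=> std1 std2 J1 J2; apply/eqP; rewrite -subr_eq0; apply/eqP.
apply: standard_ideal_eq0 => [m lead_m|].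
  by rewrite mcoeffB std1 ?std2 ?subrr.
by have := JB J2 J1; rewrite opprB addrC addrA subrK.
Qed.

(** The element is m minus its normal form.  An automorphism preserving J fixes
    m, and sends the normal form of m to another one, hence to itself. *)
Lemma reduced_element m : lead_monomial m ->
  exists g, [/\ J g, mlead g = m, mleadc g = 1 &
    forall s : {rmorphism F -> F}, (forall p, J p -> J (map_mpoly s p)) ->
      map_mpoly s g = g].
Proof.
move=> lead_m; have [r std_r Jg] := normal_form_exists 'X_[m].
have gm1 : ('X_[m] - r)@_m = 1 by rewrite mcoeffB mcoeffX eqxx std_r ?subr0.
have g_neq0 : 'X_[m] - r != 0.
  by apply/eqP => g0; move/eqP: gm1; rewrite g0 mcoeff0 eq_sym oner_eq0.
(* The monomials of g other than m are standard, and its leading one is not. *)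
have lead_g : mlead ('X_[m] - r) = m.
  have lead_lead_g : lead_monomial (mlead ('X_[m] - r)) by exists ('X_[m] - r).
  move: g_neq0; rewrite -mleadc_eq0 {1}mcoeffB mcoeffX std_r // subr0.
  by case: (m =P _) => [/esym|_ /eqP[]].
exists ('X_[m] - r); split; rewrite ?lead_g // => s Js.
rewrite rmorphB /= map_mpolyX; congr (_ - _).
apply: (@normal_form_unique 'X_[m]) => //.
  by move=> m' lead_m'; rewrite mcoeff_map_mpoly std_r // raddf0.
by have := Js _ Jg; rewrite rmorphB /= map_mpolyX.
Qed.

(** Multivariate division: the leading monomial of p in J is a multiple of one
    of the monomials given by Dickson's lemma, so a multiple of the
    corresponding reduced element, itself in J, cancels the leading term. *)
Lemma invariant_generators :
  exists d (f : 'I_d -> {mpoly F[n]}),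
    [/\ forall i, J (f i),
        forall p, J p -> exists c, p = \sum_(i < d) c i * f i
      & forall s : {rmorphism F -> F},
          (forall p, J p -> J (map_mpoly s p)) ->
          forall i, map_mpoly s (f i) = f i].
Proof.
have [M leadM domM] := dickson lead_monomial.
have /fin_all_exists[f fP] : forall i : 'I_(size M),
    exists g, [/\ J g, mlead g = nth 0%MM M i, mleadc g = 1 &
      forall s : {rmorphism F -> F}, (forall p, J p -> J (map_mpoly s p)) ->
        map_mpoly s g = g].
  by move=> i; apply: reduced_element; apply: leadM; rewrite mem_nth.
exists (size M), f; split=> [i|p|s Js i]; first by have [] := fP i.
- elim/mpoly_cancel_lead_ind: p => [_|p p_neq0 IHp Jp].
    by exists (fun=> 0); rewrite big1 // => i _; rewrite mul0r.
  have [m Mm le_m_p] := domM (mlead p) (ex_intro _ p (And3 Jp p_neq0 erefl)).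
  have lt_m : (index m M < size M)%N by rewrite index_mem.
  pose i0 := Ordinal lt_m.
  have [Jf lead_f leadc_f _] := fP i0.
  have {}lead_f : mlead (f i0) = m by rewrite lead_f /= nth_index.
  have lcp_neq0 : mleadc p != 0 by rewrite mleadc_eq0.
  pose u := mleadc p *: 'X_[mlead p - m].
  have lead_u : mlead u = (mlead p - m)%MM by rewrite mleadZ // mleadXm.
  have leadc_u : mleadc u = mleadc p.
    by rewrite lead_u mcoeffZ mcoeffX eqxx mulr1.
  have lead_uf : mlead (u * f i0) = mlead p.
    by rewrite mleadM_proper ?lead_u ?lead_f ?submK // -lead_u -lead_f
      leadc_f mulr1 leadc_u.
  have leadc_uf : mleadc (u * f i0) = mleadc p.
    by rewrite mleadcM_proper leadc_f mulr1 leadc_u.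
  have [|c def_c] := IHp _ lead_uf leadc_uf; first by apply: JB => //; apply: JM.
  exists (fun i => c i + (if i == i0 then u else 0)).
  rewrite -[LHS](subrK (u * f i0)) def_c.
  under [RHS]eq_bigr => i _ do rewrite mulrDl.
  rewrite big_split /=; congr (_ + _).
  rewrite (bigD1 i0) //= eqxx big1 ?addr0 // => i /negPf->.
  by rewrite mul0r.
by have [_ _ _] := fP i; apply.
Qed.

End InvariantGenerators.

Section Varieties.
Variables (L : closedFieldType) (k : nat).
Implicit Types (V : 'rV[L]_k -> Prop) (p : {mpoly L[k]}).

Lemma meval_map_mpoly (s : {rmorphism L -> L}) p (v : 'rV[L]_k) :
  (map_mpoly s p).@[(map_mx s v) 0] = s p.@[v 0].
Proof.
rewrite !mevalE (perm_big _ (msupp_map_mpoly p (fmorph_inj s))) rmorph_sum /=.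
apply: eq_bigr => m _; rewrite mcoeff_map_mpoly rmorphM rmorph_prod.
by congr (_ * _); apply: eq_bigr => i _; rewrite mxE rmorphXn.
Qed.

Definition vanishing_poly V p := forall v, V v -> p.@[v 0] = 0.

(** Evaluating the transform of p at v = s (t v) amounts to applying s to the
    value of p at t v, which is a point of V. *)
Lemma vanishing_poly_map V (s : {rmorphism L -> L}) (t : L -> L) :
  cancel t s -> (forall v, V v -> V (map_mx t v)) ->
  forall p, vanishing_poly V p -> vanishing_poly V (map_mpoly s p).
Proof.
move=> tK Vt p p0 v Vv.
have -> : v = map_mx s (map_mx t v) by apply/rowP => i; rewrite !mxE tK.
by rewrite meval_map_mpoly p0 ?rmorph0 //; apply: Vt.
Qed.

End Varieties.

Local Close Scope ring_scope.

Theorem theorem2 (K : fieldType) (L : closedFieldType)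
    (iota : {rmorphism K -> L}) (A : (L -> L) -> Prop)
    (k : nat) (V : 'rV[L]_k -> Prop) :
  (0 < k)%N ->
  aut_subgroup iota A ->
  defined_over (fun _ : L => True) V ->
  invariant_under A V ->
  defined_over (fixed_field A) V.
Proof.
move=> _ gA [r0 [f0 [_ _ defV]]] invV.
have [||| d [f [Jf genJ fixf]]] := @invariant_generators L k (vanishing_poly V).
- by move=> v _; rewrite meval0.
- by move=> p q p0 q0 v Vv; rewrite mevalD p0 ?q0 ?addr0.
- by move=> c p p0 v Vv; rewrite mevalM p0 ?mulr0.
have idealE p : ideal_gen f p <-> vanishing_poly V p.
  split=> [[c ->] v Vv|/genJ //].
  by rewrite rmorph_sum big1 //= => i _; rewrite mevalM Jf ?mulr0.
exists d, f; split=> [i m s As|p e /idealE pe0|v].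
- have [sB sM _ _] := aut_subgroup_sub gA As.
  have [t [At _ tK]] := aut_subgroup_inv gA As.
  pose sZ := GRing.isZmodMorphism.Build L L s sB.
  pose sR := GRing.isMonoidMorphism.Build L L s sM.
  pose s' : {rmorphism L -> L} := HB.pack s sZ sR.
  have Js' p : vanishing_poly V p -> vanishing_poly V (map_mpoly s' p).
    by apply: (vanishing_poly_map (t := t)) => // v; apply: invV.
  by rewrite -[in RHS](fixf s' Js' i) mcoeff_map_mpoly.
- apply/idealE => v Vv; have /eqP := pe0 v Vv.
  by rewrite rmorphXn expf_eq0 => /andP[_ /eqP].
split=> [Vv p /idealE|vanf]; first exact.
apply/defV => p genp; apply: vanf; apply/idealE => w /defV; exact.
Qed.
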